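(* Let $\Delta$ be a simplicial complex on $[n]$. For $i\in[n]$ the following are equivalent: (a) $i$ is a cone vertex of $\Delta$; (b) $\emptyset\in\mathcal A_i(\Delta)$; (c) $-\mathbf e_i\in\mathcal R(\Delta)$. In that case: (1) $\mathcal A_i(\Delta)=\{S\in\Delta: i\notin S\}$; (2) $\Delta=\mathcal A_i(\Delta)\cup\{S\cup\{i\}:S\in\mathcal A_i(\Delta)\}$, so $\mathcal R(\Delta)$ determines $\Delta$ (i.e. any simplicial complex on $[n]$ with the same set of Demazure roots equals $\Delta$); (3) $\Delta$ is fully exposed.
   Context: For $n\ge 1$, $[n]=\{1,\dots,n\}$. A simplicial complex $\Delta$ on $[n]$ is a collection of subsets of $[n]$ (faces) closed under taking subsets; it is always assumed that $\{i\}\in\Delta$ for every $i\in[n]$. Facets are the inclusion-maximal faces. A vertex $i$ is a cone vertex if it lies in every facet. For a face $S$, $\operatorname{cl}(S)$ is the intersection of all facets containing $S$. For $i\in[n]$, $\mathcal A_i(\Delta)=\{S\subseteq[n]\setminus\{i\}: S\in\Delta,\ i\in\operatorname{cl}(S)\}$. A facet $F$ is exposed if there exist $i\in[n]$ and $S\in\mathcal A_i(\Delta)$ with $S\subseteq F$. $\Delta$ is fully exposed if every facet is exposed. With $\mathbf e_i$ the standard basis vectors of $\mathbb Z^n$ and $\operatorname{supp}(a)=\{i:a_i\neq0\}$ (so $\operatorname{supp}(0)=\emptyset$), the set of Demazure roots of $\Delta$ is $\mathcal R(\Delta)=\{\beta-\mathbf e_i: i\in[n],\ \beta\in\mathbb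 Z^n_{\ge0},\ \beta_i=0,\ \operatorname{supp}(\beta)\in\mathcal A_i(\Delta)\}$. *)

(* Defs.v *)
From mathcomp Require Import all_boot all_order all_algebra.

Set Implicit Arguments.
Unset Strict Implicit.
Unset Printing Implicit Defensive.

Import GRing.Theory Num.Theory.
Local Open Scope ring_scope.

(* The vertex set [n] = {1, ..., n} is modelled by the ordinals 'I_n. *)

Definition simplicial_complex (n : nat) (D : {set {set 'I_n}}) : Prop :=
  (forall S T : {set 'I_n}, S \subset T -> T \in D -> S \in D) /\
  (forall i : 'I_n, [set i] \in D).

Definition facets (n : nat) (D : {set {set 'I_n}}) : {set {set 'I_n}} :=
  [set F : {set 'I_n} | maxset (fun S => S \in D) F].

Definition cone_vertex (n : nat) (D : {set {set 'I_n}}) (i : 'I_n) : Prop :=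
  forall F : {set 'I_n}, F \in facets D -> i \in F.

(* Meaningful only for S \in D: for other S the intersection is empty-indexed
   and yields [set: 'I_n]. *)
Definition cl (n : nat) (D : {set {set 'I_n}}) (S : {set 'I_n}) : {set 'I_n} :=
  \bigcap_(F in facets D | S \subset F) F.

Definition calA (n : nat) (D : {set {set 'I_n}}) (i : 'I_n) :
    {set {set 'I_n}} :=
  [set S : {set 'I_n} | [&& S \subset [set~ i], S \in D & i \in cl D S]].

Definition exposed (n : nat) (D : {set {set 'I_n}}) (F : {set 'I_n}) : Prop :=
  exists i : 'I_n, exists2 S : {set 'I_n}, S \in calA D i & S \subset F.

Definition fully_exposed (n : nat) (D : {set {set 'I_n}}) : Prop :=
  forall F : {set 'I_n}, F \in facets D -> exposed D F.

Definition basis_vec (n : nat) (i : 'I_n) : 'rV[int]_n := delta_mx 0 i.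

Definition supp (n : nat) (a : 'rV[int]_n) : {set 'I_n} :=
  [set j : 'I_n | a 0 j != 0].

(* The set R(D) of Demazure roots, as a predicate on Z^n. *)
Definition demazure_roots (n : nat) (D : {set {set 'I_n}}) (v : 'rV[int]_n) :
    Prop :=
  exists (i : 'I_n) (beta : 'rV[int]_n),
    [/\ forall j : 'I_n, 0 <= beta 0 j,
        beta 0 i = 0,
        supp beta \in calA D i
      & v = beta - basis_vec i].

(* Main.v *)
Require Import Defs.
From mathcomp Require Import all_boot all_order all_algebra.

Set Implicit Arguments.
Unset Strict Implicit.
Unset Printing Implicit Defensive.

Import GRing.Theory Num.Theory.
Local Open Scope ring_scope.

(** The condition that [i] lies in the closure of the empty face says that [i]
    lies in every facet, since every facet contains the empty set; so [i] is a
    cone vertex exactly when [calA D i] contains the empty set.  Two facts then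
    do the work.

    On the combinatorial side, every face [S] extends to a facet, and a cone
    vertex [i] lies in that facet; hence [i |: S] is again a face.  So [D] is
    the cone with apex [i] over the faces avoiding [i], and those faces are
    exactly [calA D i] (lemmas [calA_cone] and [cone_decomposition]).  As the
    empty set lies in [calA D i] and in every facet, all facets are exposed.

    On the side of roots, a Demazure root has exactly one negative coordinate,
    which is [-1] at the index subtracted.  The index [i] and the vector [beta]
    can therefore be read off from [beta - basis_vec i]
    (lemma [demazure_rootE]), and since every set avoiding [i] is the support
    of such a [beta], the roots determine [calA D i] for each [i]
    (lemma [calA_of_roots]).  If [i] is a cone vertex of [D], then the root
    [- basis_vec i] makes it a cone vertex of any complex with the same roots,
    and both complexes are the cone over one and the same [calA D i]. *)

Lemma calAP (n : nat) (D : {set {set 'I_n}}) (i : 'I_n) (S : {set 'I_n}) :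
  reflect [/\ i \notin S, S \in D
            & forall F : {set 'I_n}, F \in facets D -> S \subset F -> i \in F]
          (S \in calA D i).
Proof.
rewrite inE subsetC sub1set inE.
apply: (iffP and3P) => -[iS SD icl]; split=> //.
  by move=> F Ffacet SF; move/bigcapP: icl; apply; rewrite Ffacet.
by apply/bigcapP => F /andP[Ffacet SF]; apply: icl.
Qed.

Lemma set0_face (n : nat) (D : {set {set 'I_n}}) (i : 'I_n) :
  simplicial_complex D -> set0 \in D.
Proof. by case=> Dsub Dvertex; apply: (Dsub _ [set i]); rewrite ?sub0set. Qed.

Lemma cone_vertex_calA (n : nat) (D : {set {set 'I_n}}) (i : 'I_n) :
  simplicial_complex D -> cone_vertex D i <-> set0 \in calA D i.
Proof.
move=> hD; split=> [icone | /calAP[_ _ icone] F Ffacet].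
  by apply/calAP; split; rewrite ?inE ?(set0_face i hD) // => F /icone.
by apply: icone => //; apply: sub0set.
Qed.

Lemma face_sub_facet (n : nat) (D : {set {set 'I_n}}) (S : {set 'I_n}) :
  S \in D -> exists2 F, F \in facets D & S \subset F.
Proof.
move=> SD; have [F Fmax SF] := @maxset_exists _ (fun S => S \in D) S SD.
by exists F; rewrite ?inE.
Qed.

Lemma calA_cone (n : nat) (D : {set {set 'I_n}}) (i : 'I_n) :
  cone_vertex D i -> calA D i = [set S in D | i \notin S].
Proof.
move=> icone; apply/setP => S; rewrite [RHS]inE.
apply/calAP/andP => [[iS SD _] // | [SD iS]].
by split=> // F /icone.
Qed.

(** Joining the apex to a face stays inside any facet that contains it. *)
Lemma cone_vertexU1 (n : nat) (D : {set {set 'I_n}}) (i : 'I_n)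
    (S : {set 'I_n}) :
  simplicial_complex D -> cone_vertex D i -> S \in D -> i |: S \in D.
Proof.
move=> [Dsub _] icone /face_sub_facet[F Ffacet SF].
apply: (Dsub _ F); first by rewrite subUset sub1set icone.
by move: Ffacet; rewrite inE => /maxsetp.
Qed.

(** A face through the apex [i] is recovered from its trace [S :\ i] on the
    base of the cone. *)
Lemma cone_decomposition (n : nat) (D : {set {set 'I_n}}) (i : 'I_n) :
  simplicial_complex D -> cone_vertex D i ->
  D = calA D i :|: [set i |: S | S in calA D i].
Proof.
move=> hD icone; rewrite (calA_cone icone); apply/setP => S.
apply/idP/setUP => [SD | [| /imsetP[T]]].
- have [iS | iS] := boolP (i \in S); last by left; rewrite inE SD.
  right; apply/imsetP; exists (S :\ i); last by rewrite setD1K.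
  by rewrite !inE eqxx andbT; apply: hD.1 SD; apply: subsetDl.
- by rewrite inE => /andP[].
- by rewrite inE => /andP[TD _] ->; apply: cone_vertexU1.
Qed.

(** A representation of [b - basis_vec i] as a root can only subtract
    [basis_vec i] and add [b]: its coordinate at [i] is [-1], whereas
    [beta - basis_vec j] is nonnegative away from [j]. *)
Lemma demazure_rootE (n : nat) (D : {set {set 'I_n}}) (i : 'I_n)
    (b : 'rV[int]_n) :
  (forall j : 'I_n, 0 <= b 0 j) -> b 0 i = 0 ->
  demazure_roots D (b - basis_vec i) <-> supp b \in calA D i.
Proof.
move=> b_ge0 bi0; split=> [[j [beta [beta_ge0 _ betaA eq_root]]] | bA].
  have ji : j = i.
    apply/eqP; case: eqVneq => // neq_ji.
    move/rowP/(_ i): eq_root (beta_ge0 i).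
    rewrite !mxE bi0 !eqxx /= (eq_sym i) (negPf neq_ji) /= subr0 sub0r.
    by move=> <-.
  by move: eq_root betaA; rewrite ji => /addIr ->.
by exists i, b; split.
Qed.

Lemma set0_calA_root (n : nat) (D : {set {set 'I_n}}) (i : 'I_n) :
  set0 \in calA D i <-> demazure_roots D (- basis_vec i).
Proof.
have supp0 : supp 0 = set0 :> {set 'I_n}.
  by apply/setP => j; rewrite !inE mxE eqxx.
rewrite -supp0 -[- basis_vec i]add0r.
by apply: iff_sym; apply: demazure_rootE => [j |]; rewrite mxE.
Qed.

(** For [i \notin S], membership of [S] in [calA D i] is tested by one root:
    the indicator vector of [S] minus [basis_vec i]. *)
Lemma calA_of_roots (n : nat) (D D' : {set {set 'I_n}}) (i : 'I_n) :
  (forall v : 'rV[int]_n, demazure_roots D' v <-> demazure_roots D v) ->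
  calA D' i = calA D i.
Proof.
move=> eqR; apply/setP => S; have [iS | iS] := boolP (i \in S).
  by apply/calAP/calAP => -[]; rewrite iS.
pose b : 'rV[int]_n := \row_j (j \in S)%:R.
have suppb : supp b = S.
  by apply/setP => j; rewrite inE mxE; case: (j \in S).
have b_ge0 j : 0 <= b 0 j by rewrite mxE ler0n.
have bi0 : b 0 i = 0 by rewrite mxE (negPf iS).
have rootE E := demazure_rootE E b_ge0 bi0.
by rewrite -suppb; apply/idP/idP => /rootE /eqR /rootE.
Qed.

Theorem lemma2p14 (n : nat) (hn : (1 <= n)%N) (D : {set {set 'I_n}})
    (hD : simplicial_complex D) (i : 'I_n) :
  ((cone_vertex D i <-> set0 \in calA D i) /\
   (set0 \in calA D i <-> demazure_roots D (- basis_vec i))) /\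
  (cone_vertex D i ->
   [/\ calA D i = [set S in D | i \notin S],
       D = calA D i :|: [set i |: S | S in calA D i],
       (forall D' : {set {set 'I_n}}, simplicial_complex D' ->
          (forall v : 'rV[int]_n, demazure_roots D' v <-> demazure_roots D v) ->
          D' = D)
     & fully_exposed D]).
Proof.
have coneE := cone_vertex_calA i hD.
split=> [| icone]; first by split=> //; apply: set0_calA_root.
split; first exact: calA_cone; first exact: cone_decomposition.
- move=> D' hD' eqR; have eqA := calA_of_roots i eqR.
  have icone' : cone_vertex D' i.
    by apply/(cone_vertex_calA i hD'); rewrite eqA; apply/coneE.
  by rewrite (cone_decomposition hD' icone') eqA -cone_decomposition.
- by move=> F _; exists i, set0; [apply/coneE | apply: sub0set].
Qed.
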